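(* Consider the problem of minimizing $\varphi(x)+\frac1S\sum_{s=1}^S\psi(x;\xi^s)$ over $x\in X$ in the setting described in the context, and suppose Assumptions A and B (stated in the context) hold for every scenario $\xi^1,\dots,\xi^S$. Let $\{x_\nu\}_{\nu\ge 0}$ be any sequence generated by the decomposition algorithm described in the context. Then any accumulation point $\bar x$ of $\{x_\nu\}_{\nu\ge0}$ is a critical point of the problem, in the sense that $$0\in\partial\varphi(\bar x)+\frac1S\sum_{s=1}^S\Big[\partial_1\overline\psi(\bar x,\bar x;\xi^s)-\partial_2(-\overline\psi)(\bar x,\bar x;\xi^s)\Big]+\mathcal N_X(\bar x).$$
   Context: Setting. $X,\overline X\subseteq\mathbb R^{n_1}$ are nonempty convex compact sets with $X\subseteq\operatorname{int}(\overline X)$; $\varphi:\mathbb R^{n_1}\to\mathbb R$ is convex; $\xi^1,\dots,\xi^S$ are fixed scenarios in a closed set $\Xi\subseteq\mathbb R^m$. For each scenario $\xi$, the functions $f(\cdot,\cdot;\xi):\mathbb R^{n_1+n_2}\to\mathbb R$ and $G(\cdot,\cdot;\xi)=(g_1,\dots,g_\ell)^\top(\cdot,\cdot;\xi):\mathbb R^{n_1+n_2}\to\mathbb R^\ell$ are continuous, $f(\cdot,y;\xi)$ is concave for every $y$, $f(x,\cdot;\xi)$ is convex for every $x$, and each $g_i(\cdot,\cdot;\xi)$ is jointly convex. Recourse function: $\psi(x;\xi)=\min_y\{f(x,y;\xi): G(x,y;\xi)\le0\}$ if $x\in\overline X$, and $+\infty$ otherwise. Lifted function: $\overline\psi(x,z;\xi)=\min_y\{f(z,y;\xi):G(x,y;\xi)\le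 0\}$ if $x,z\in\overline X$; $+\infty$ if $x\notin\overline X$; $-\infty$ if $x\in\overline X$, $z\notin\overline X$. $\partial_1\overline\psi(x,z;\xi)$ is the convex subdifferential of $\overline\psi(\cdot,z;\xi)$ at $x$ (for $z\in\overline X$), $\partial_2(-\overline\psi)(x,z;\xi)$ is the convex subdifferential of $-\overline\psi(x,\cdot;\xi)$ at $z$ (for $x\in\overline X$), and $\partial_1(-f)(x,y;\xi)$ is the convex subdifferential of $-f(\cdot,y;\xi)$ at $x$. $\mathcal N_X$ is the normal cone of $X$. Assumption A: for each scenario $\xi$, the minimization over $y$ defining $\overline\psi(x,z;\xi)$ has an optimal solution for every $(x,z)\in\overline X\times\overline X$. Assumption B: for each scenario $\xi$ there is a finite $\kappa_1(\xi)\ge0$ with $|\overline\psi(x_1,z;\xi)-\overline\psi(x_2,z;\xi)|\le\kappa_1(\xi)\|x_1-x_2\|$ for all $x_1,x_2\in\overline X$, $z\in X$. Partial Moreau envelope: for $\gamma>0$ and $z\in X$, $$e_\gamma\psi(z;\xi)=\min_{x\in\overline X,\,y\in\mathbb R^{n_2}}\Big\{f(z,y;\xi)+\tfrac1{2\gamma}\|x-z\|^2: G(x,y;\xi)\le0\Big\}.\qquad( * )$$ Decomposition algorithm. Input: $x_0\in X$ and positive sequences $\gamma_\nu\downarrow0$, $\varepsilon_\nu\downarrow0$. For $\nu=0,1,2,\dots$ run the following inner loop, started with $i=0$, $x_{\nu,0}=x_\nu$: (1) for each $s$ let $(x^s_{\nu,i},y^s_{\nu,i})$ be an optimal solution of $(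 * )$ with $(z,\xi,\gamma)=(x_{\nu,i},\xi^s,\gamma_\nu)$; (2) for each $s$ choose $c^s_{\nu,i}\in\partial_1(-f)(x_{\nu,i},y^s_{\nu,i};\xi^s)\subseteq\partial_2(-\overline\psi)(x^s_{\nu,i},x_{\nu,i};\xi^s)$; (3) let $x_{\nu,i+1}$ be the minimizer over $x\in X$ of $\varphi(x)+\frac1S\sum_{s=1}^S\widehat e_{\gamma_\nu}\psi(x;\xi^s;x_{\nu,i})$, where $\widehat e_{\gamma_\nu}\psi(x;\xi^s;x_{\nu,i})=\frac1{2\gamma_\nu}\|x\|^2-\big[\frac1{2\gamma_\nu}\|x_{\nu,i}\|^2-e_{\gamma_\nu}\psi(x_{\nu,i};\xi^s)\big]-\big(x^s_{\nu,i}/\gamma_\nu+c^s_{\nu,i}\big)^\top(x-x_{\nu,i})$; (4) if $\|x_{\nu,i+1}-x_{\nu,i}\|>\varepsilon_\nu\gamma_\nu$, replace $i$ by $i+1$ and repeat; otherwise stop the inner loop and set $x_{\nu+1}=x_{\nu,i+1}$. *)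

(* Defs.v *)
From HB Require Import structures.
From mathcomp Require Import all_boot all_order all_algebra.
From mathcomp Require Import all_classical all_reals all_analysis.

Set Implicit Arguments.
Unset Strict Implicit.
Unset Printing Implicit Defensive.

Import Order.TTheory GRing.Theory Num.Theory.
Import numFieldNormedType.Exports.

Local Open Scope classical_set_scope.
Local Open Scope ring_scope.

Section Euclidean.
Context {R : realType} {n : nat}.
Implicit Types (u v x : 'rV[R]_n) (A B X : set 'rV[R]_n).

Definition dot u v : R := (u *m v^T) 0 0.

(* The library norm on 'rV[R]_n is the sup norm; the topology is the same, but
   the proximal term and the stopping test need the Euclidean norm. *)
Definition enorm u : R := Num.sqrt (dot u u).

Definition msetD A B : set 'rV[R]_n := [set a + b | a in A & b in B].
Definition msetB A B : set 'rV[R]_n := [set a - b | a in A & b in B].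
Definition msetZ (k : R) A : set 'rV[R]_n := [set k *: a | a in A].
Definition mset_sum (I : finType) (A : I -> set 'rV[R]_n) : set 'rV[R]_n :=
  [set \sum_i a i | a in [set a : I -> 'rV[R]_n | forall i, A i (a i)]].

(* Convex subdifferential of an extended-real-valued function; empty at points
   where the function is not finite. *)
Definition subdifferential (h : 'rV[R]_n -> \bar R) x : set 'rV[R]_n :=
  [set v | h x \is a fin_num /\
           forall x', (h x + (dot v (x' - x))%:E <= h x')%E].

Definition normal_cone X x : set 'rV[R]_n :=
  [set v | X x /\ forall x', X x' -> dot v (x' - x) <= 0].

End Euclidean.

Definition minimizer {R : realType} {T : Type} (A : set T) (h : T -> R) (a : T) :=
  A a /\ forall b, A b -> h a <= h b.

Section Recourse.
Context {R : realType} {n1 n2 l : nat}.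
(* f and G are the data of a single scenario. *)
Variables (Xbar : set 'rV[R]_n1) (f : 'rV[R]_n1 -> 'rV[R]_n2 -> R)
  (G : 'rV[R]_n1 -> 'rV[R]_n2 -> 'rV[R]_l).
Implicit Types (x z c : 'rV[R]_n1) (y : 'rV[R]_n2) (gamma : R).

Definition feasible x : set 'rV[R]_n2 := [set y | forall i, G x y 0 i <= 0].

(* The minima over y are written as infima in \bar R: see lifted_recourse_min. *)
Definition recourse x : \bar R :=
  if x \in Xbar then ereal_inf [set (f x y)%:E | y in feasible x] else +oo%E.

Definition lifted_recourse x z : \bar R :=
  if x \in Xbar then
    if z \in Xbar then ereal_inf [set (f z y)%:E | y in feasible x] else -oo%E
  else +oo%E.

Lemma lifted_recourse_diag x : lifted_recourse x x = recourse x.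
Proof. by rewrite /lifted_recourse /recourse; case: (x \in Xbar). Qed.

Lemma lifted_recourse_min x z y : Xbar x -> Xbar z ->
  minimizer (feasible x) (f z) y -> lifted_recourse x z = (f z y)%:E.
Proof.
move=> Xx Xz [yF ymin]; rewrite /lifted_recourse !mem_set//.
apply/eqP; rewrite eq_le; apply/andP; split.
  by apply: ereal_inf_lbound; apply: imageP.
by apply: le_ereal_inf_tmp => _ [y' /ymin ? <-]; rewrite lee_fin.
Qed.

Definition lifted_solvable : Prop :=
  forall x z, Xbar x -> Xbar z -> exists y, minimizer (feasible x) (f z) y.

Definition lifted_lipschitz (X : set 'rV[R]_n1) : Prop :=
  exists2 kappa : R, 0 <= kappa & forall x1 x2 z, Xbar x1 -> Xbar x2 -> X z ->
    (`|lifted_recourse x1 z - lifted_recourse x2 z|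
       <= (kappa * enorm (x1 - x2))%:E)%E.

Definition subdiff1_lifted x z : set 'rV[R]_n1 :=
  subdifferential (lifted_recourse ^~ z) x.

Definition subdiff2_opp_lifted x z : set 'rV[R]_n1 :=
  subdifferential (fun z' => - lifted_recourse x z')%E z.

Definition subdiff1_opp_cost x y : set 'rV[R]_n1 :=
  subdifferential (fun x' => (- f x' y)%:E) x.

Definition prox_feasible : set ('rV[R]_n1 * 'rV[R]_n2) :=
  [set p | Xbar p.1 /\ feasible p.1 p.2].

Definition prox_objective gamma z (p : 'rV[R]_n1 * 'rV[R]_n2) : R :=
  f z p.2 + (2 * gamma)^-1 * enorm (p.1 - z) ^+ 2.

(* Real-valued infimum: equal to the minimum whenever a minimizer exists. *)
Definition moreau_envelope gamma z : R :=
  inf [set prox_objective gamma z p | p in prox_feasible].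

Lemma moreau_envelope_min gamma z p :
  minimizer prox_feasible (prox_objective gamma z) p ->
  moreau_envelope gamma z = prox_objective gamma z p.
Proof.
move=> [pF pmin]; apply/eqP; rewrite eq_le; apply/andP; split.
  apply: ge_inf; last by exists p.
  by exists (prox_objective gamma z p) => _ [q /pmin ? <-].
by apply: lb_le_inf => [|_ [q /pmin ? <-]//]; exists (prox_objective gamma z p), p.
Qed.

(* Strongly convex quadratic model of the envelope at z, built from the
   proximal point xs and a subgradient c. *)
Definition moreau_surrogate gamma z xs c x : R :=
  (2 * gamma)^-1 * enorm x ^+ 2
  - ((2 * gamma)^-1 * enorm z ^+ 2 - moreau_envelope gamma z)
  - dot (gamma^-1 *: xs + c) (x - z).

End Recourse.

Section Decomposition.
Context {R : realType} {n1 n2 l S : nat}.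
Variables (X Xbar : set 'rV[R]_n1) (phi : 'rV[R]_n1 -> R)
  (f : 'I_S -> 'rV[R]_n1 -> 'rV[R]_n2 -> R)
  (G : 'I_S -> 'rV[R]_n1 -> 'rV[R]_n2 -> 'rV[R]_l).
Implicit Types (x z w : 'rV[R]_n1) (gamma eps : R).

Definition critical_point x : Prop :=
  msetD
    (msetD (subdifferential (EFin \o phi) x)
       (msetZ S%:R^-1
          (mset_sum (fun s : 'I_S =>
             msetB (subdiff1_lifted Xbar (f s) (G s) x x)
                   (subdiff2_opp_lifted Xbar (f s) (G s) x x)))))
    (normal_cone X x) 0.

(* One pass from z = x_{nu,i} to w = x_{nu,i+1}. *)
Definition inner_step gamma z w : Prop :=
  exists (xs : 'I_S -> 'rV[R]_n1) (ys : 'I_S -> 'rV[R]_n2)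
         (cs : 'I_S -> 'rV[R]_n1),
    [/\ forall s, minimizer (prox_feasible Xbar (G s))
                            (prox_objective (f s) gamma z) (xs s, ys s),
        forall s, subdiff1_opp_cost (f s) z (ys s) (cs s)
      & minimizer X (fun x => phi x + S%:R^-1 *
          \sum_s moreau_surrogate Xbar (f s) (G s) gamma z (xs s) (cs s) x) w].

(* A complete inner loop: u i = x_{nu,i}, and the stopping test first succeeds
   at the pass i = N. *)
Definition inner_loop gamma eps z w : Prop :=
  exists (u : nat -> 'rV[R]_n1) (N : nat),
    [/\ u 0%N = z,
        forall i, (i <= N)%N -> inner_step gamma (u i) (u i.+1),
        forall i, (i < N)%N -> eps * gamma < enorm (u i.+1 - u i),
        enorm (u N.+1 - u N) <= eps * gamma
      & w = u N.+1].

Definition generated_by_decomposition (gamma eps : nat -> R)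
    (x : nat -> 'rV[R]_n1) : Prop :=
  X (x 0%N) /\ forall nu, inner_loop (gamma nu) (eps nu) (x nu) (x nu.+1).

End Decomposition.

(* Main.v *)
Require Import Defs.
From mathcomp Require Import all_boot all_order all_algebra.
From mathcomp Require Import all_classical all_reals all_analysis.
From mathcomp Require Import ring lra.

(* Let z be the iterate entering the last pass of the inner loop nu, w = x_{nu+1},
   and b_s = (z - x^s)/gamma_nu.
   - Optimality of (x^s, y^s) gives b_s in the first partial subdifferential of
     the lifted function at (x^s, z); comparing with the point z, Assumption B
     bounds |b_s| by kappa_1, so x^s - z -> 0.
   - Optimality of w is a variational inequality for phi on X with slope
     mean(c_s - b_s) + (z - w)/gamma_nu, and the last term tends to 0 by the
     stopping test.
   - The c_s are subgradients of - lifted(x^s, .) at z; they stay bounded because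
     the accumulation point is interior to Xbar, where convex functions are
     continuous.
   Along an ultrafilter refining both the index filter and the convergence to
   xbar, all these bounded families converge, and the inequalities pass to the
   limit. The limiting variational inequality splits into a subgradient of phi
   and a normal to X by a sandwich (Hahn-Banach) argument. *)

Set Implicit Arguments.
Unset Strict Implicit.
Unset Printing Implicit Defensive.

Import Order.TTheory GRing.Theory Num.Theory.
Import numFieldNormedType.Exports.

Local Open Scope classical_set_scope.
Local Open Scope ring_scope.

(** * Convexity with plain real coefficients *)

(** A bare real coefficient lets the inequalities go straight into [lra]. The general module [V]
    covers the product space on which the constraints are jointly convex. *)
Definition convex_on (R : realType) (V : lmodType R) (A : set V) (h : V -> R) :=
  forall x y t, A x -> A y -> 0 <= t <= 1 ->
    h (t *: x + (1 - t) *: y) <= t * h x + (1 - t) * h y.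

Definition convex_stable (R : realType) (V : lmodType R) (A : set V) :=
  forall x y t, A x -> A y -> 0 <= t <= 1 -> A (t *: x + (1 - t) *: y).

Lemma convex_function_on (R : realType) (V : lmodType R) (h : V -> R) :
  convex_function setT h -> convex_on setT h.
Proof.
move=> hc x y t _ _ /andP[t0 t1].
exact: (hc (Itv01 t0 t1) x y (in_setT _) (in_setT _)).
Qed.

Lemma convex_set_stable (R : realType) (V : lmodType R) (A : set V) :
  convex_set A -> convex_stable A.
Proof.
move=> Ac x y t Ax Ay /andP[t0 t1].
exact: (set_mem (Ac x y (Itv01 t0 t1) (mem_set Ax) (mem_set Ay))).
Qed.

(** * Sublinear functions and their straightening *)

Section Sandwich.
Context {R : realType} {V : lmodType R}.
Implicit Types (p q : V -> R) (u v : V) (t : R).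

(** Homogeneity is asked as an inequality only; using it for t and for 1/t gives the equality. *)
Definition sublinear p :=
  (forall t u, 0 < t -> p (t *: u) <= t * p u) /\
  (forall u v, p (u + v) <= p u + p v).

Lemma sublinear0 p : sublinear p -> p 0 = 0.
Proof.
move=> [pZ _]; have := pZ 2 0 ltac:(lra); have := pZ 2^-1 0 ltac:(lra).
rewrite !scaler0; lra.
Qed.

(* The infimum over [t >= 0] of [p (u + t *: v) - t * p v] is sublinear, below
   [p], and linear along the line spanned by [v]. *)
Lemma sublinear_straighten p v : sublinear p ->
  exists q, [/\ sublinear q, forall u, q u <= p u & q (- v) <= - q v].
Proof.
move=> psub; have p0 := sublinear0 psub; have [pZ pD] := psub.
pose E u := [set p (u + t *: v) - t * p v | t in [set t | 0 <= t]].
(* The infimum is finite because t p(v) <= p(tv) <= p(-u) + p(u + tv). *)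
have Elb u : lbound (E u) (- p (- u)).
  move=> _ [t /= t0 <-]; have := pD (- u) (u + t *: v).
  rewrite addKr; case: (ltrgtP t 0) t0 => // [tgt0|->] _; last first.
    by rewrite scale0r p0 addr0; lra.
  have := pZ t^-1 (t *: v); rewrite invr_gt0 scalerA mulVf ?gt_eqF// scale1r.
  by move=> /(_ tgt0); rewrite mulrC ler_pdivlMr//; lra.
have Einf u : has_inf (E u).
  by split; [exists (p (u + 0 *: v) - 0 * p v), 0 => /= | exists (- p (- u))].
have Ele u t : 0 <= t -> inf (E u) <= p (u + t *: v) - t * p v.
  by move=> t0; apply: ge_inf; [case: (Einf u) | exists t].
have Ege u a : (forall t, 0 <= t -> a <= p (u + t *: v) - t * p v) ->
    a <= inf (E u).
  by move=> ha; apply: lb_le_inf => [|_ [t t0 <-]]; [case: (Einf u) | exact: ha].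
have Ep u : inf (E u) <= p u.
  by have := Ele u 0 (lexx _); rewrite scale0r addr0 mul0r subr0.
exists (fun u => inf (E u)); split => //.
- split=> [t u t0|u w].
    rewrite mulrC -ler_pdivrMr//; apply: (Ege _ _) => s s0; rewrite ler_pdivrMr//.
    have := Ele (t *: u) (t * s) (mulr_ge0 (ltW t0) s0).
    have := pZ t (u + s *: v) t0; rewrite scalerDr scalerA; lra.
  rewrite -lerBlDr; apply: (Ege _ _) => s s0; rewrite lerBlDr -lerBlDl.
  apply: (Ege _ _) => t t0; have := Ele (u + w) (s + t) (addr_ge0 s0 t0).
  have := pD (u + s *: v) (w + t *: v); rewrite scalerDl addrACA; lra.
(* Taking t = 1 at u = -v gives q(-v) <= p(0) - p(v) = -p(v) <= -q(v). *)
- have := Ele (- v) 1 ler01; rewrite scale1r addNr p0 mul1r.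
  have := Ep v; lra.
Qed.

(** Straightening along a new direction keeps the earlier ones: lowering q to q' gives q'(-u) <=
    q(-u) <= -q(u) <= -q'(u). *)
Lemma sublinear_straighten_seq p (s : seq V) : sublinear p ->
  exists q, [/\ sublinear q, forall u, q u <= p u &
    forall v, v \in s -> q (- v) <= - q v].
Proof.
move=> psub; elim: s => [|v s [q [qsub qp qs]]]; first by exists p.
have [q' [q'sub q'q q'v]] := sublinear_straighten v qsub.
exists q'; split=> // [u|u]; first exact: le_trans (q'q u) (qp u).
rewrite inE => /predU1P[->//|/qs]; have := q'q (- u).
have := sublinear0 q'sub; have := q'sub.2 u (- u); rewrite subrr.
have := sublinear0 qsub; have := q'q u; have := qsub.2 u (- u); rewrite subrr.
lra.
Qed.

End Sandwich.

(** * Euclidean inner product and norm *)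

Section Dot.
Context {R : realType} {n : nat}.
Implicit Types (u v w : 'rV[R]_n) (t : R).

Lemma dotE u v : dot u v = \sum_i u 0 i * v 0 i.
Proof. by rewrite /dot mxE; apply: eq_bigr => i _; rewrite mxE. Qed.

Lemma dotC u v : dot u v = dot v u.
Proof. by rewrite !dotE; apply: eq_bigr => i _; rewrite mulrC. Qed.

Lemma dotDl u v w : dot (u + v) w = dot u w + dot v w.
Proof. by rewrite /dot mulmxDl mxE. Qed.

Lemma dotNl u w : dot (- u) w = - dot u w.
Proof. by rewrite /dot mulNmx mxE. Qed.

Lemma dotZl t u w : dot (t *: u) w = t * dot u w.
Proof. by rewrite /dot -scalemxAl mxE. Qed.

Lemma dotDr u v w : dot w (u + v) = dot w u + dot w v.
Proof. by rewrite ![dot w _]dotC dotDl. Qed.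

Lemma dotNr u w : dot w (- u) = - dot w u.
Proof. by rewrite ![dot w _]dotC dotNl. Qed.

Lemma dotZr t u w : dot w (t *: u) = t * dot w u.
Proof. by rewrite ![dot w _]dotC dotZl. Qed.

Definition dot_lin := (dotDl, dotDr, dotNl, dotNr, dotZl, dotZr).

Lemma dot_suml (I : finType) (a : I -> 'rV[R]_n) w :
  dot (\sum_i a i) w = \sum_i dot (a i) w.
Proof.
apply: (big_morph (fun u => dot u w)) => [u v|]; first exact: dotDl.
by rewrite /dot mul0mx mxE.
Qed.

Lemma dot_delta u i : dot u (delta_mx 0 i) = u 0 i.
Proof.
rewrite dotE (bigD1 i)//= big1 ?mxE ?eqxx ?mulr1 ?addr0// => j ji.
by rewrite mxE (negbTE ji) mulr0.
Qed.

Lemma dot_ge0 u : 0 <= dot u u.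
Proof. by rewrite dotE sumr_ge0// => i _; rewrite -expr2 sqr_ge0. Qed.

Lemma enorm_ge0 u : 0 <= enorm u.
Proof. exact: sqrtr_ge0. Qed.

Lemma sqr_enorm u : enorm u ^+ 2 = dot u u.
Proof. by rewrite sqr_sqrtr// dot_ge0. Qed.

Lemma enormZ t u : 0 <= t -> enorm (t *: u) = t * enorm u.
Proof.
move=> t0; rewrite /enorm !dot_lin mulrA -expr2 sqrtrM ?sqr_ge0//.
by rewrite sqrtr_sqr ger0_norm.
Qed.

Lemma enormN u : enorm (- u) = enorm u.
Proof. by rewrite /enorm !dot_lin opprK. Qed.

Lemma coord_le_enorm u i : `|u 0 i| <= enorm u.
Proof.
rewrite -sqrtr_sqr /enorm ler_sqrt ?dot_ge0// dotE (bigD1 i)//= -expr2 lerDl.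
by rewrite sumr_ge0// => j _; rewrite -expr2 sqr_ge0.
Qed.

End Dot.

(** * Finite-dimensional Hahn-Banach and sandwich theorems *)

(** Straightening along the canonical basis replaces Zorn's lemma. With L read off on the basis,
    subadditivity gives q <= L, and then L(u) = -L(-u) <= -q(-u) <= q(u) <= p(u). *)
Lemma sublinear_minorant (R : realType) (n : nat) (p : 'rV[R]_n -> R) :
  sublinear p -> exists L, forall u, dot L u <= p u.
Proof.
move=> psub.
have [q [qsub qp qe]] := sublinear_straighten_seq [seq delta_mx 0 i | i : 'I_n] psub.
have q0 := sublinear0 qsub; have [qZ qD] := qsub.
pose L : 'rV[R]_n := \row_i q (delta_mx 0 i); exists L.
have qdot u : q u <= dot L u.
  rewrite [u in q u]row_sum_delta dotE.
  apply: (big_ind2 (fun a b => q a <= b)) => [|a b c d|i _]; first by rewrite q0.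
    by move=> ac bd; apply: le_trans (qD _ _) (lerD ac bd).
  rewrite mxE; set e := delta_mx 0 i; set t := u 0 i.
  have qei : q (- e) <= - q e by apply: qe; apply: map_f; rewrite mem_enum.
  case: (ltrgtP t 0) => [t0|t0|->]; last by rewrite scale0r q0 mulr0.
    have := qZ (- t) (- e); rewrite scaleNr scalerN opprK oppr_gt0 => /(_ t0).
    have : - t * q (- e) <= - t * - q e by rewrite ler_wpM2l// oppr_ge0 ltW.
    lra.
  by rewrite mulrC; apply: qZ.
move=> u; apply: le_trans (qp u).
have := qdot (- u); rewrite dotNr; have := qD u (- u); rewrite subrr q0; lra.
Qed.

(* The infimum of [h (t *: u + c) / t] over [t > 0] and [c] in [C] is sublinear
   in [u], at most [h], and nonpositive on [- C]. *)
Lemma convex_sandwich (R : realType) (n : nat) (h : 'rV[R]_n -> R)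
    (C : set 'rV[R]_n) :
  convex_on setT h -> convex_stable C -> C 0 -> h 0 = 0 ->
  (forall c, C c -> 0 <= h c) ->
  exists L, (forall u, dot L u <= h u) /\ (forall c, C c -> 0 <= dot L c).
Proof.
move=> hc Cc C0 h0 hC.
pose E u := [set h (a.1 *: u + a.2) / a.1 | a in [set a | 0 < a.1 /\ C a.2]].
(* With weights 1/(1+t) and t/(1+t), the points tu + c and -u combine to c/(1+t), which lies in C on
   the segment from 0 to c, so h is nonnegative there. *)
have Elb u : lbound (E u) (- h (- u)).
  move=> _ [[t c] /= [t0 Cc'] <-].
  rewrite ler_pdivlMr//.
  have s0 : 0 < 1 + t by lra.
  have t1 : 0 <= (1 + t)^-1 <= 1.
    by rewrite invr_ge0 ltW//= invf_le1//; lra.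
  have e1 : 1 - (1 + t)^-1 = t / (1 + t) by field; rewrite gt_eqF.
  have := hc (t *: u + c) (- u) _ I I t1.
  have -> : (1 + t)^-1 *: (t *: u + c) + (1 - (1 + t)^-1) *: - u
            = (1 + t)^-1 *: c + (1 - (1 + t)^-1) *: 0.
    rewrite e1 scaler0 addr0 scalerDr scalerN scalerA addrAC.
    by rewrite [(1 + t)^-1 * t]mulrC subrr add0r.
  have := hC _ (Cc _ _ _ Cc' C0 t1); rewrite e1.
  move=> A B; have := le_trans A B.
  have -> : (1 + t)^-1 * h (t *: u + c) + t / (1 + t) * h (- u)
     = (h (t *: u + c) + t * h (- u)) / (1 + t) by field; rewrite gt_eqF.
  rewrite pmulr_lge0 ?invr_gt0//; lra.
have Einf u : has_inf (E u).
  by split; [exists (h (1 *: u + 0) / 1), (1, 0) => /= | exists (- h (- u))].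
have Ele u t c : 0 < t -> C c -> inf (E u) <= h (t *: u + c) / t.
  by move=> t0 Cc'; apply: ge_inf; [case: (Einf u) | exists (t, c)].
have Ege u a : (forall t c, 0 < t -> C c -> a <= h (t *: u + c) / t) ->
    a <= inf (E u).
  move=> ha; apply: lb_le_inf => [|_ [[t c] [/= t0 ?] <-]]; last exact: ha.
  by case: (Einf u).
have psub : sublinear (fun u => inf (E u)).
  split=> [t u t0|u v].
    rewrite mulrC -ler_pdivrMr//; apply: (Ege _ _) => s c s0 Cc'; rewrite ler_pdivrMr//.
    have := Ele (t *: u) (s / t) c (divr_gt0 s0 t0) Cc'.
    by rewrite scalerA divfK ?gt_eqF// invf_div mulrCA mulrC.
  rewrite -lerBlDr; apply: (Ege _ _) => s c s0 Cs; rewrite lerBlDr -lerBlDl.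
  apply: (Ege _ _) => t d t0 Cd; rewrite lerBlDr.
  have st0 : 0 < s + t by lra.
  (* These weights give u and v the same coefficient st/(s+t) in the combination of su + c and tv +
     d. *)
  pose r := t / (s + t).
  have r01 : 0 <= r <= 1.
    by rewrite (divr_ge0 (ltW t0) (ltW st0)) ler_pdivrMr//; lra.
  have r1 : 1 - r = s / (s + t) by rewrite /r; field; rewrite gt_eqF.
  have := Ele (u + v) (s * t / (s + t)) (r *: c + (1 - r) *: d)
    (divr_gt0 (mulr_gt0 s0 t0) st0) (Cc _ _ _ Cs Cd r01).
  have -> : (s * t / (s + t)) *: (u + v) + (r *: c + (1 - r) *: d)
    = r *: (s *: u + c) + (1 - r) *: (t *: v + d).
    rewrite !scalerDr !scalerA r1 /r addrACA.
    by congr (_ *: _ + _ + (_ *: _ + _)); field; rewrite gt_eqF.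
  have := hc (s *: u + c) (t *: v + d) r I I r01; rewrite r1 /r.
  move: (h _) (h _) (h _) => a b e H1 H2; apply: le_trans H2 _.
  rewrite ler_pdivrMr ?divr_gt0 ?mulr_gt0//; apply: le_trans H1 _.
  rewrite le_eqVlt; apply/orP; left; apply/eqP; field.
  by rewrite !gt_eqF.
have [L HL] := sublinear_minorant psub; exists L; split=> [u|c Cc'].
  apply: le_trans (HL u) _; have := Ele u 1 0 ltr01 C0.
  by rewrite scale1r addr0 divr1.
(* At u = -c, the choice t = 1 with the point c itself evaluates h at 0. *)
have := le_trans (HL (- c)) (Ele (- c) 1 c ltr01 Cc').
by rewrite scale1r addNr h0 mul0r dotNr; lra.
Qed.

(** * Coordinate boxes and continuity of convex functions *)

Lemma rV_box_nbhs (R : realType) (n : nat) (A : set 'rV[R]_n) (a : 'rV[R]_n) :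
  nbhs a A <->
  exists2 r : R, 0 < r & forall d : 'rV[R]_n, (forall i, `|d 0 i| <= r) -> A (a + d).
Proof.
split=> [/nbhs_ballP[r /= r0 rA]|[r r0 rA]].
  exists (r / 2) => [|d dr]; first by rewrite divr_gt0.
  apply: rA; split=> // i j; rewrite ord1 /ball /= mxE opprD addNKr normrN.
  by rewrite (le_lt_trans (dr j))// gtr_pMr// invf_lt1 ?ltr1n.
apply/nbhs_ballP; exists r => //= v [_ av]; rewrite -[v](subrKC a).
apply: rA => i; have := av 0 i; rewrite /ball /= distrC !mxE.
exact: ltW.
Qed.

Lemma rV_cvgP (R : realType) (n : nat) (T : Type) (F : set_system T)
    (FF : Filter F) (u : T -> 'rV[R]_n) (a : 'rV[R]_n) :
  (forall i, u t 0 i @[t --> F] --> a 0 i) <-> u @ F --> a.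
Proof.
split=> [ua|ua i]; last first.
  by apply: (cvg_comp u (fun v : 'rV_n => v 0 i) ua); exact: coord_continuous.
move=> A /rV_box_nbhs[r r0 rA].
have : \forall t \near F, forall i, i \in 'I_n -> `|a 0 i - u t 0 i| <= r.
  apply: filter_forall => i.
  by apply: filterS ((cvgrPdist_le _ _).1 (ua i) _ r0) => t.
apply: filterS => t ht /=; rewrite -[u t](subrKC a).
by apply: rA => i; rewrite !mxE distrC; apply: ht.
Qed.

Section ConvexContinuity.
Context {R : realType} {n : nat}.
Variables (A : set 'rV[R]_n) (h : 'rV[R]_n -> R) (a : 'rV[R]_n).
Hypotheses (hc : convex_on A h) (aA : nbhs a A).

Lemma convex_on_le_max b c t : A b -> A c -> 0 <= t <= 1 ->
  h (t *: b + (1 - t) *: c) <= Num.max (h b) (h c).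
Proof.
move=> Ab Ac t01; apply: le_trans (hc Ab Ac t01) _; move/andP: t01 => [t0 t1].
set m := Num.max _ _.
have hb : h b <= m by rewrite le_max lexx.
have hc' : h c <= m by rewrite le_max lexx orbT.
have := ler_wpM2l t0 hb; have := ler_wpM2l (_ : 0 <= 1 - t) hc'; lra.
Qed.

(* Coordinates are freed one at a time: a point of the box is the midpoint of a
   point on an axis and a point with one more zero coordinate, both in the
   doubled box. *)
Lemma convex_bounded_above : exists2 r : R, 0 < r & exists M : R, forall d : 'rV[R]_n,
  (forall i, `|d 0 i| <= r) -> A (a + d) /\ h (a + d) <= M.
Proof.
have [r0 r0_gt0 r0A] := (rV_box_nbhs _ _).1 aA.
suff /(_ n)[r [r_gt0 rr0 [M HM]]] : forall k : nat, exists r : R, [/\ 0 < r, r <= r0 &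
    exists M : R, forall d : 'rV[R]_n, (forall i, `|d 0 i| <= r) ->
      (forall i : 'I_n, (k <= i)%N -> d 0 i = 0) -> h (a + d) <= M].
  exists r => //; exists M => d dr; split.
    by apply: r0A => i; apply: le_trans (dr i) rr0.
  by apply: HM => // i; rewrite leqNgt ltn_ord.
elim=> [|k [r [r_gt0 rr0 [M HM]]]].
  exists r0; split=> //; exists (h a) => d _ d0.
  suff -> : d = 0 by rewrite addr0.
  by apply/rowP => i; rewrite mxE d0.
have [kn|kn] := ltnP k n; last first.
  exists r; split=> //; exists M => d dr d0; apply: HM => // i ki; apply: d0.
  by have := ltn_ord i; rewrite ltnNge (leq_trans kn ki).
pose e : 'rV[R]_n := delta_mx 0 (Ordinal kn).
have eA t : `|t| <= r0 -> A (a + t *: e).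
  move=> tr; apply: r0A => i; rewrite !mxE eqxx /=.
  by case: (i == _); rewrite ?mulr1// mulr0 normr0 ltW.
exists (r / 2); split; [by rewrite divr_gt0 | by lra|].
pose M' := Num.max (h (a + r *: e)) (h (a + (- r) *: e)).
exists (Num.max M M') => d dr d0.
pose d' : 'rV[R]_n := \row_i (if i == Ordinal kn then 0 else 2 * d 0 i).
pose s := d 0 (Ordinal kn).
have sr : `|s| <= r / 2 by apply: dr.
have dE : a + d = 2^-1 *: (a + d') + (1 - 2^-1) *: (a + (2 * s) *: e).
  apply/rowP => i; rewrite !mxE eqxx /= /s; case: eqVneq => [->|_] /=; lra.
have d'r i : `|d' 0 i| <= r.
  rewrite mxE; case: ifP => _; first by rewrite normr0 ltW.
  by rewrite normrM ger0_norm//; have := dr i; lra.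
have Mle : h (a + d') <= M.
  apply: HM => // i ki; rewrite mxE; case: eqVneq => // ik.
  rewrite d0 ?mulr0// ltn_neqAle ki andbT; apply/eqP => E; case/eqP: ik.
  exact/val_inj.
have M'le : h (a + (2 * s) *: e) <= M'.
  (* The axis point lies between a - r e and a + r e because |s| <= r/2. *)
  pose t := (2 * s + r) / (2 * r).
  have -> : a + (2 * s) *: e = t *: (a + r *: e) + (1 - t) *: (a + (- r) *: e).
    apply/rowP => i; rewrite !mxE eqxx /=; case: (i == _) => /=; rewrite /t; field.
      by rewrite gt_eqF.
    by rewrite gt_eqF.
  apply: convex_on_le_max.
  - by apply: eA; rewrite gtr0_norm.
  - by apply: eA; rewrite normrN gtr0_norm.
  - have /andP[s1 s2] : - (r/2) <= s <= r / 2 by rewrite -ler_norml.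
    apply/andP; split; first by apply: divr_ge0; lra.
    by rewrite ler_pdivrMr; lra.
rewrite dE; apply: le_trans (convex_on_le_max _ _ _) _.
- by apply: r0A => i; apply: le_trans rr0.
- apply: eA; rewrite normrM ger0_norm//; lra.
- lra.
by rewrite ge_max; apply/andP; split; rewrite le_max; apply/orP; [left | right].
Qed.

(** An upper bound M near a suffices. Writing a + d between a and a + d/t bounds h(a + d) - h(a) by
    t (M - h(a)); writing a between a + d and a - d/t bounds h(a) - h(a + d) by the same
    quantity. *)
Lemma convex_continuous_at : {for a, continuous h}.
Proof.
have [r r0 [M HM]] := convex_bounded_above.
have Aa : A a by exact: nbhs_singleton.
have [] := HM 0; first by move=> i; rewrite mxE normr0 ltW.
rewrite addr0 => _ haM.
apply/(cvgrPdist_le (FF := nbhs_filter a)) => e e0.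
(* The added 1 keeps the denominator of [t] positive when M = h(a). *)
have K0 : 0 < M - h a + 1 by lra.
pose t := Num.min 1 (e / (M - h a + 1)).
have t0 : 0 < t by rewrite lt_min ltr01 divr_gt0.
have t1 : t <= 1 by rewrite ge_min lexx.
have te : t * (M - h a) <= e.
  have : t <= e / (M - h a + 1) by rewrite ge_min lexx orbT.
  by rewrite ler_pdivlMr//; have := ltW t0; lra.
apply/rV_box_nbhs; exists (t * r) => [|d dr]; first by rewrite mulr_gt0.
have [Ap hp] : A (a + t^-1 *: d) /\ h (a + t^-1 *: d) <= M.
  apply: HM => i; rewrite mxE normrM [X in X * _]gtr0_norm ?invr_gt0//.
  by rewrite ler_pdivrMl//; apply: dr.
have [An hn] : A (a + (- t^-1) *: d) /\ h (a + (- t^-1) *: d) <= M.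
  apply: HM => i; rewrite mxE normrM normrN [X in X * _]gtr0_norm ?invr_gt0//.
  by rewrite ler_pdivrMl//; apply: dr.
have Ad : A (a + d).
  by apply: (HM d _).1 => i; rewrite (le_trans (dr i))// ger_pMl.
have up := hc Ap Aa (_ : 0 <= t <= 1).
have s1 : 0 < 1 + t by lra.
pose s := (1 + t)^-1.
have s01 : 0 <= s <= 1 by rewrite invr_ge0 ltW//= invf_le1//; lra.
have := hc Ad An s01.
have -> : s *: (a + d) + (1 - s) *: (a + (- t^-1) *: d) = a.
  by apply/rowP => i; rewrite !mxE /s; field; rewrite !gt_eqF.
have -> : s * h (a + d) + (1 - s) * h (a + (- t^-1) *: d)
    = (h (a + d) + t * h (a + (- t^-1) *: d)) / (1 + t).
  by rewrite /s; field; rewrite gt_eqF.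
rewrite ler_pdivlMr// => lo.
have := up ltac:(lra).
have -> : t *: (a + t^-1 *: d) + (1 - t) *: a = a + d.
  by apply/rowP => i; rewrite !mxE; field; rewrite gt_eqF.
have := ler_wpM2l (ltW t0) hp; have := ler_wpM2l (ltW t0) hn.
rewrite ler_norml; lra.
Qed.

End ConvexContinuity.

(** * Ultrafilters in place of subsequences *)

Lemma fmap_ultra (T U : Type) (f : T -> U) (F : set_system T) :
  UltraFilter F -> UltraFilter (f @ F).
Proof.
move=> FU; split; first exact: fmap_proper_filter.
move=> G GP FG; apply/seteqP; split=> // A GA.
have [//|FnA] := in_ultra_setVsetC (f @^-1` A) FU.
have /FG GnA : (f @ F) (~` A) by [].
by have [u []] := filter_ex (filterI GA GnA).
Qed.

(** The sets of indices in a member of F whose images lie in a given neighbourhood of a are nonempty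
    and generate a proper filter; any ultrafilter above it serves. *)
Lemma cluster_ultra (T : Type) (V : topologicalType) (u : T -> V)
    (F : set_system T) a : ProperFilter F -> cluster (u @ F) a ->
  exists U, [/\ UltraFilter U, F `<=` U & u @ U --> a].
Proof.
move=> FF ua.
pose D := [set AB : set T * set V | F AB.1 /\ nbhs a AB.2].
pose B (AB : set T * set V) := AB.1 `&` u @^-1` AB.2.
have BF : Filter (filter_from D B).
  apply: filter_from_filter; first by exists (setT, setT); split; exact: filterT.
  move=> [A1 B1] [A2 B2] [/= FA1 aB1] [/= FA2 aB2].
  exists (A1 `&` A2, B1 `&` B2); first by split; exact: filterI.
  by move=> t [[? ?] [? ?]].
have BP : ProperFilter (filter_from D B).
  apply: filter_from_proper => -[A1 B1] [/= FA1 aB1].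
  have [v [[t At <-] B1v]] : (u @` A1) `&` B1 !=set0.
    by apply: ua aB1; apply: (@filterS _ F _ A1) => // t; exists t.
  by exists t.
have [U [UU sU]] := ultraFilterLemma BP; exists U; split=> // A HA; apply: sU.
  by exists (A, setT); [split=> //; exact: filterT | move=> t []].
by exists (setT, A); [split=> //; exact: filterT | move=> t []].
Qed.

(** Compactness of a box makes every bounded family converge along one and the same ultrafilter, so
    several families converge together without successive extractions. *)
Lemma ultra_bounded_cvg (R : realType) (n : nat) (T : Type) (U : set_system T)
    (u : T -> 'rV[R]_n) (K : R) : UltraFilter U ->
  (\forall t \near U, forall i, `|u t 0 i| <= K) -> exists a : 'rV[R]_n, u @ U --> a.
Proof.
move=> UU uK.
have Kc := rV_compact (fun i : 'I_n => @segment_compact R (- K) K).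
rewrite compact_ultra in Kc.
have [|a [_ ua]] := Kc (u @ U) (fmap_ultra u UU); last by exists a.
by apply: filterS uK => t uK i /=; rewrite in_itv /= -ler_norml.
Qed.

(** * Limits and coordinate bounds along a filter *)

Section Limits.
Context {R : realType} {n : nat} {T : Type} (F : set_system T) {FF : ProperFilter F}.
Implicit Types (u v : T -> 'rV[R]_n) (a b : 'rV[R]_n) (A : set 'rV[R]_n).

Lemma dot_cvg u v a b : u @ F --> a -> v @ F --> b ->
  dot (u t) (v t) @[t --> F] --> dot a b.
Proof.
move=> /rV_cvgP ua /rV_cvgP vb; rewrite dotE.
under eq_fun do rewrite dotE.
by apply: cvg_big => [|i _]; [exact: add_continuous | exact: cvgM].
Qed.

Lemma enorm_cvg u a : u @ F --> a -> enorm (u t) @[t --> F] --> enorm a.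
Proof.
move=> ua; 
exact: (cvg_comp (fun t => dot (u t) (u t)) Num.sqrt (dot_cvg ua ua)
  (@sqrt_continuous R (dot a a))).
Qed.

Lemma enorm_squeeze u (e : T -> R) :
  (forall t, enorm (u t) <= e t) -> e @ F --> 0 -> u @ F --> (0 : 'rV[R]_n).
Proof.
move=> ue e0; apply/rV_cvgP => i; rewrite mxE; apply/norm_cvg0P.
apply: (squeeze_cvgr (f := fun=> 0) (h := e)) => //; last exact: cvg_cst.
by apply: nearW => t; rewrite normr_ge0 (le_trans (coord_le_enorm _ _)).
Qed.

(** Testing at the finitely many points a + r e_j and a - r e_j bounds r |u_j|, up to the error of
    replacing v by a. That error is at most d times the l1 norm N of u, and summing over j absorbs
    it. *)
Lemma coord_bounded_of_dot u v a A : nbhs a A -> v @ F --> a ->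
  (forall y, A y -> exists K, \forall t \near F, dot (u t) (y - v t) <= K) ->
  exists K, \forall t \near F, forall i, `|u t 0 i| <= K.
Proof.
move=> /rV_box_nbhs[r r0 rA] va uK.
have /choice[K KP] : forall p : 'I_n * bool, exists K, \forall t \near F,
    dot (u t) (a + ((-1) ^+ p.2 * r) *: delta_mx 0 p.1 - v t) <= K.
  move=> [i s]; apply: uK; apply: rA => j; rewrite !mxE eqxx /= !normrM normr_sign.
  rewrite mul1r (gtr0_norm r0); case: (j == i) => /=.
    by rewrite normr1 mulr1.
  by rewrite normr0 mulr0 ltW.
pose M := \sum_i (Num.max (K (i, true)) (K (i, false))).
exists (2 * M / r).
(* Chosen so that n d <= r/2, whence r N <= M + (r/2) N; the successor also covers dimension 0. *)
pose d := r / (2 * n.+1%:R).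
have d0 : 0 < d by rewrite divr_gt0// mulr_gt0.
have nd : n%:R * d <= r / 2.
  have : d * (2 * n.+1%:R) = r by rewrite divfK// mulf_neq0.
  by rewrite -[n.+1%:R]natr1; lra.
have /rV_cvgP vai := va.
have Fv : \forall t \near F, forall i, i \in 'I_n -> `|a 0 i - v t 0 i| <= d.
  by apply: filter_forall => i; apply: filterS ((cvgrPdist_le _ _).1 (vai i) _ d0).
have Fu : \forall t \near F, forall p, p \in [set: 'I_n * bool]%SET ->
    dot (u t) (a + ((-1) ^+ p.2 * r) *: delta_mx 0 p.1 - v t) <= K p.
  by apply: filter_forall => p; apply: filterS (KP p).
near=> t => i.
have vt j : `|a 0 j - v t 0 j| <= d by have := near Fv t; apply.
have ut (p : 'I_n * bool) : dot (u t) (a + ((-1) ^+ p.2 * r) *: delta_mx 0 p.1 - v t) <= K p.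
  by have := near Fu t; apply; rewrite ?inE.
set N := \sum_j `|u t 0 j|.
have dN : `|dot (u t) (a - v t)| <= d * N.
  rewrite dotE (le_trans (ler_norm_sum _ _ _))// mulr_sumr; apply: ler_sum => j _.
  by rewrite normrM mulrC ler_wpM2r// !mxE.
have uj j : r * `|u t 0 j| <= Num.max (K (j, true)) (K (j, false)) + d * N.
  rewrite ler_norml in dN; have /andP[dN1 dN2] := dN.
  have := ut (j, true); have := ut (j, false) => /=.
  rewrite ![a + _ - _]addrAC !dotDr !dotZr dot_delta expr0 expr1 mul1r mulN1r.
  have : K (j, true) <= Num.max (K (j, true)) (K (j, false)) by rewrite le_max lexx.
  have : K (j, false) <= Num.max (K (j, true)) (K (j, false)).
    by rewrite le_max lexx orbT.
  rewrite !dotDr in dN1 dN2 *.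
  by case: (ger0P (u t 0 j)); lra.
have rN : r * N <= M + r / 2 * N.
  rewrite mulr_sumr; apply: le_trans (ler_sum _ (fun j _ => uj j)) _.
  rewrite big_split /= sumr_const card_ord lerD2l -(mulr_natl (d * N)) mulrA ler_wpM2r//.
  exact: sumr_ge0.
have iN : `|u t 0 i| <= N.
  by rewrite /N (bigD1 i)//= lerDl sumr_ge0.
by rewrite (le_trans iN)// ler_pdivlMr//; lra.
Unshelve. all: by end_near.
Qed.

End Limits.

(** * Optimality for a convex function plus a quadratic *)

(** Compare w with w + t (x - w): the quadratic remainder is of order t^2, so division by t leaves
    the error t alpha |x - w|^2, arbitrarily small. This serves both the proximal problem and the
    surrogate problem. *)
Lemma prox_variational (R : realType) (n : nat) (A : set 'rV[R]_n)
    (h : 'rV[R]_n -> R) (alpha : R) (p w : 'rV[R]_n) :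
  convex_stable A -> convex_on A h -> A w -> 0 <= alpha ->
  (forall x, A x ->
    h w + alpha * dot w w - dot p w <= h x + alpha * dot x x - dot p x) ->
  forall x, A x -> h w + dot (p - (2 * alpha) *: w) (x - w) <= h x.
Proof.
move=> Ac hc Aw a0 wmin x Ax; move dE : (x - w) => d.
have dd0 := dot_ge0 d; have K0 := mulr_ge0 a0 dd0.
apply/ler_addgt0Pr => e e0.
have K1 : 0 < alpha * dot d d + 1 by lra.
pose t := Num.min 1 (e / (alpha * dot d d + 1)).
have t0 : 0 < t by rewrite lt_min ltr01 divr_gt0.
have t1 : t <= 1 by rewrite ge_min lexx.
have te : t * (alpha * dot d d) <= e.
  have : t <= e / (alpha * dot d d + 1) by rewrite ge_min lexx orbT.
  by rewrite ler_pdivlMr//; have := ltW t0; lra.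
have t01 : 0 <= t <= 1 by rewrite (ltW t0).
have := wmin _ (Ac _ _ _ Ax Aw t01); have := hc _ _ _ Ax Aw t01.
have -> : t *: x + (1 - t) *: w = w + t *: d.
  by rewrite -dE; apply/rowP => i; rewrite !mxE; ring.
rewrite !dot_lin ![dot d w]dotC => H1 H2.
suff : t * (h w + (dot p d - 2 * alpha * dot w d)) <= t * (h x + e).
  by rewrite ler_pM2l.
have : t * (t * (alpha * dot d d)) <= t * e by rewrite ler_pM2l.
lra.
Qed.

Lemma cvg_le (R : realType) (T : Type) (F : set_system T) {FF : ProperFilter F}
    (u v : T -> R) (a b : R) :
  u @ F --> a -> v @ F --> b -> (forall t, u t <= v t) -> a <= b.
Proof.
move=> ua vb uv; rewrite -subr_ge0.
apply: (closed_cvg (fun r : R => 0 <= r) (@closed_ge R 0) _ _ (cvgB vb ua)).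
by apply: nearW => t; rewrite subr_ge0.
Qed.

(** * The lifted recourse function and its subgradients *)

Section LiftedRecourse.
Context {R : realType} {n1 n2 l : nat}.
Variables (Xbar : set 'rV[R]_n1) (f : 'rV[R]_n1 -> 'rV[R]_n2 -> R)
  (G : 'rV[R]_n1 -> 'rV[R]_n2 -> 'rV[R]_l).
Hypotheses (Xbar_stable : convex_stable Xbar)
  (f_concave : forall y, convex_on setT (fun x => - f x y))
  (f_convex : forall x, convex_on setT (f x))
  (G_convex : forall i : 'I_l, convex_on setT
     (fun p : 'rV[R]_n1 * 'rV[R]_n2 => G p.1 p.2 0 i))
  (solvable : lifted_solvable Xbar f G).
Implicit Types (x z c : 'rV[R]_n1) (y : 'rV[R]_n2) (gamma : R).

(** [fine] sends infinite values to 0, so this is faithful only on Xbar x Xbar, where the minimum is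
    attained. *)
Definition lval x z : R := fine (lifted_recourse Xbar f G x z).

Lemma lval_min x z y : Xbar x -> Xbar z ->
  minimizer (feasible G x) (f z) y -> lval x z = f z y.
Proof. by move=> Xx Xz ymin; rewrite /lval (lifted_recourse_min Xx Xz ymin). Qed.

Lemma lifted_recourseE x z : Xbar x -> Xbar z ->
  lifted_recourse Xbar f G x z = (lval x z)%:E.
Proof.
move=> Xx Xz; have [y ymin] := solvable Xx Xz.
by rewrite (lval_min Xx Xz ymin) (lifted_recourse_min Xx Xz ymin).
Qed.

Lemma lval_attained x z : Xbar x -> Xbar z ->
  exists2 y, feasible G x y & lval x z = f z y.
Proof.
move=> Xx Xz; have [y ymin] := solvable Xx Xz.
by exists y; [case: ymin | exact: lval_min].
Qed.

Lemma lval_le x z y : Xbar x -> Xbar z -> feasible G x y -> lval x z <= f z y.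
Proof.
move=> Xx Xz yF; have [y' y'min] := solvable Xx Xz.
by rewrite (lval_min Xx Xz y'min); case: y'min => _; apply.
Qed.

Lemma feasible_convex x1 x2 y1 y2 t : 0 <= t <= 1 ->
  feasible G x1 y1 -> feasible G x2 y2 ->
  feasible G (t *: x1 + (1 - t) *: x2) (t *: y1 + (1 - t) *: y2).
Proof.
move=> t01 F1 F2 i.
apply: le_trans (G_convex i (x := (x1, y1)) (y := (x2, y2)) I I t01) _ => /=.
have := F1 i; have := F2 i; case/andP: t01 => t0 t1 h2 h1.
have := mulr_ge0_le0 t0 h1; have := mulr_ge0_le0 (_ : 0 <= 1 - t) h2; lra.
Qed.

(** Joint convexity of G makes the combination of two minimizers feasible at the combined point. *)
Lemma lval_convex z : Xbar z -> convex_on Xbar (lval^~ z).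
Proof.
move=> Xz x1 x2 t Xx1 Xx2 t01.
have [y1 F1 ->] := lval_attained Xx1 Xz; have [y2 F2 ->] := lval_attained Xx2 Xz.
apply: le_trans (f_convex z I I t01).
exact: lval_le (Xbar_stable Xx1 Xx2 t01) Xz (feasible_convex t01 F1 F2).
Qed.

(** The feasible set does not depend on z, so a minimizer at the combined point is a competitor at
    both endpoints. *)
Lemma lval_concave x : Xbar x -> convex_on Xbar (fun z => - lval x z).
Proof.
move=> Xx z1 z2 t Xz1 Xz2 t01.
have [y yF ->] := lval_attained Xx (Xbar_stable Xz1 Xz2 t01).
apply: le_trans (f_concave y I I t01) _.
case/andP: t01 => t0 t1.
have := ler_wpM2l t0 (lval_le Xx Xz1 yF).
have := ler_wpM2l (_ : 0 <= 1 - t) (lval_le Xx Xz2 yF); lra.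
Qed.

(** Outside [Xbar] the lifted value is +oo, so only real inequalities on [Xbar] remain. *)
Lemma subdiff1_lval x z v : Xbar x -> Xbar z ->
  (forall x', Xbar x' -> lval x z + dot v (x' - x) <= lval x' z) ->
  subdiff1_lifted Xbar f G x z v.
Proof.
move=> Xx Xz hv; rewrite /subdiff1_lifted /subdifferential /= lifted_recourseE//.
split=> // x'; have [/set_mem Xx'|nXx'] := boolP (x' \in Xbar).
  by rewrite lifted_recourseE// -EFinD lee_fin hv.
by rewrite /lifted_recourse (negbTE nXx') leey.
Qed.

Lemma subdiff2_lval x z v : Xbar x -> Xbar z ->
  (forall z', Xbar z' -> - lval x z + dot v (z' - z) <= - lval x z') ->
  subdiff2_opp_lifted Xbar f G x z v.
Proof.
move=> Xx Xz hv.
rewrite /subdiff2_opp_lifted /subdifferential /= lifted_recourseE//.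
split=> // z'; have [/set_mem Xz'|nXz'] := boolP (z' \in Xbar).
  by rewrite lifted_recourseE// -!EFinN -EFinD lee_fin hv.
by rewrite /lifted_recourse (mem_set Xx) (negbTE nXz') leey.
Qed.

Lemma lval_lipschitz X : X `<=` Xbar -> lifted_lipschitz Xbar f G X ->
  exists2 kappa, 0 <= kappa & forall x1 x2 z, Xbar x1 -> Xbar x2 -> X z ->
    `|lval x1 z - lval x2 z| <= kappa * enorm (x1 - x2).
Proof.
move=> XXbar [kappa kappa0 hk]; exists kappa => // x1 x2 z Xx1 Xx2 Xz.
by have := hk _ _ _ Xx1 Xx2 Xz; rewrite !lifted_recourseE//; exact: XXbar.
Qed.

Section ProximalStep.
Variables (gamma : R) (z xs : 'rV[R]_n1) (ys : 'rV[R]_n2).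
Hypotheses (gamma_gt0 : 0 < gamma) (Xz : Xbar z)
  (prox_min : minimizer (prox_feasible Xbar G) (prox_objective f gamma z) (xs, ys)).

(** With x frozen at xs the proximal term is constant, so ys solves the lifted problem at (xs,
    z). *)
Lemma prox_lval : lval xs z = f z ys.
Proof.
have [[/= Xxs ysF] pmin] := prox_min; apply: lval_min => //; split=> // y yF.
by have := pmin (xs, y) (conj Xxs yF); rewrite /prox_objective /= lerD2r.
Qed.

(** Minimizing out y and expanding the square leaves [lval] in x plus a quadratic, to which
    [prox_variational] applies with p = z/gamma. *)
Lemma prox_subgradient x : Xbar x ->
  lval xs z + dot (gamma^-1 *: (z - xs)) (x - xs) <= lval x z.
Proof.
have [[/= Xxs ysF] pmin] := prox_min.
have g0 : 0 <= (2 * gamma)^-1 by rewrite invr_ge0 mulr_ge0// ltW.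
have g2 : 2 * (2 * gamma)^-1 = gamma^-1 by field; rewrite gt_eqF.
have H x' : Xbar x' ->
    lval xs z + (2 * gamma)^-1 * dot xs xs - dot (gamma^-1 *: z) xs <=
    lval x' z + (2 * gamma)^-1 * dot x' x' - dot (gamma^-1 *: z) x'.
  move=> Xx'; have [y yF ->] := lval_attained Xx' Xz; rewrite prox_lval.
  have := pmin (x', y) (conj Xx' yF).
  rewrite /prox_objective /= !sqr_enorm !dot_lin -g2 (dotC xs z) (dotC x' z); lra.
move=> Xx; have := prox_variational Xbar_stable (lval_convex Xz) Xxs g0 H Xx.
by rewrite g2 scalerBr.
Qed.

(** The subgradient inequality tested at z reads |z - xs|^2 / gamma <= lval(z, z) - lval(xs, z) <=
    kappa |z - xs|. *)
Lemma prox_displacement (X : set 'rV[R]_n1) kappa : 0 <= kappa -> X z ->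
  (forall x1 x2 z, Xbar x1 -> Xbar x2 -> X z ->
    `|lval x1 z - lval x2 z| <= kappa * enorm (x1 - x2)) ->
  enorm (gamma^-1 *: (z - xs)) <= kappa.
Proof.
move=> k0 XXz hk; have [[/= Xxs _] _] := prox_min.
have := prox_subgradient Xz; have := hk _ _ _ Xz Xxs XXz.
rewrite dotZl -sqr_enorm enormZ ?invr_ge0 ?(ltW gamma_gt0)//.
set d := enorm _; have d0 : 0 <= d := enorm_ge0 _.
rewrite ler_norml => /andP[_ H1] H2.
have : gamma^-1 * d ^+ 2 <= kappa * d by lra.
case: (ltrgtP d 0) d0 => // [d0|->] _; last by move=> _; rewrite mulr0.
by rewrite expr2 mulrA ler_pM2r.
Qed.

(** Since ys stays feasible at xs, f(z', ys) majorizes lval(xs, z'), with equality at z' = z; a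
    subgradient of the cost thus passes to the lifted function. *)
Lemma cost_subgradient c z' : subdiff1_opp_cost f z ys c -> Xbar z' ->
  - lval xs z + dot c (z' - z) <= - lval xs z'.
Proof.
move=> [_ /(_ z')]; rewrite -EFinD lee_fin prox_lval => H Xz'.
have [[/= Xxs ysF] _] := prox_min.
by apply: le_trans H _; rewrite lerN2; exact: lval_le.
Qed.

End ProximalStep.

Section Limit.
Context {T : Type} (F : set_system T) {FF : ProperFilter F}.
Variables (X : set 'rV[R]_n1) (kappa : R) (a : 'rV[R]_n1) (z xs : T -> 'rV[R]_n1).
Hypotheses (aXbar : nbhs a Xbar)
  (lip : forall x1 x2 z, Xbar x1 -> Xbar x2 -> X z ->
    `|lval x1 z - lval x2 z| <= kappa * enorm (x1 - x2))
  (Xz : forall t, X (z t)) (Xxs : forall t, Xbar (xs t))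
  (za : z @ F --> a) (xsa : xs @ F --> a).

Let Xa : Xbar a := nbhs_singleton aXbar.

Lemma lval_cvg1 x' : Xbar x' -> lval (xs t) x' @[t --> F] --> lval a x'.
Proof.
move=> Xx'; 
exact: (cvg_comp xs (lval^~ x') xsa (convex_continuous_at (lval_convex Xx') aXbar)).
Qed.

Lemma lval_cvg2 x' : Xbar x' -> lval x' (z t) @[t --> F] --> lval x' a.
Proof.
move=> Xx'; rewrite -[lval x' a]opprK.
under eq_fun do rewrite -[lval x' _]opprK.
apply: cvgN; exact: (cvg_comp z (fun v => - lval x' v) za
  (convex_continuous_at (lval_concave Xx') aXbar)).
Qed.

(** Joint convergence: the Lipschitz constant is uniform over z in X, which handles the first
    argument, and concavity gives continuity in the second. *)
Lemma lval_cvg : lval (xs t) (z t) @[t --> F] --> lval a a.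
Proof.
have e0 : (fun t => kappa * enorm (xs t - a)) @ F --> 0.
  rewrite -[0](mulr0 kappa); apply: cvgMr.
  rewrite (_ : 0 = enorm (a - a)); last first.
    by rewrite subrr /enorm /dot mul0mx mxE sqrtr0.
  exact: enorm_cvg (cvgB xsa (cvg_cst a)).
have d0 : (fun t => lval (xs t) (z t) - lval a (z t)) @ F --> 0.
  apply/norm_cvg0P.
  apply: (squeeze_cvgr (f := fun=> 0) (h := fun t => kappa * enorm (xs t - a))) => //.
    by apply: nearW => t; rewrite normr_ge0 lip.
  exact: cvg_cst.
rewrite -[lval a a]add0r.
rewrite (_ : (fun t => _) =
    (fun t => (lval (xs t) (z t) - lval a (z t)) + lval a (z t))).
  exact: cvgD d0 (lval_cvg2 Xa).
by apply/funext => t; rewrite subrK.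
Qed.

Lemma subdiff1_limit (b : T -> 'rV[R]_n1) b0 : b @ F --> b0 ->
  (forall t x, Xbar x -> lval (xs t) (z t) + dot (b t) (x - xs t) <= lval x (z t)) ->
  subdiff1_lifted Xbar f G a a b0.
Proof.
move=> bb0 hb; apply: subdiff1_lval => // x Xx.
apply: (cvg_le (cvgD lval_cvg (dot_cvg bb0 (cvgB (cvg_cst x) xsa)))
  (lval_cvg2 Xx)).
by move=> t; exact: hb.
Qed.

Lemma subdiff2_limit (c : T -> 'rV[R]_n1) c0 : c @ F --> c0 ->
  (forall t x, Xbar x -> - lval (xs t) (z t) + dot (c t) (x - z t) <= - lval (xs t) x) ->
  subdiff2_opp_lifted Xbar f G a a c0.
Proof.
move=> cc0 hc; apply: subdiff2_lval => // x Xx.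
apply: (cvg_le (cvgD (cvgN lval_cvg) (dot_cvg cc0 (cvgB (cvg_cst x) za)))
  (cvgN (lval_cvg1 Xx))).
by move=> t; exact: hc.
Qed.

(* The second-stage solutions may be unbounded, so the subgradients are bounded
   through the lifted function and not through the cost. *)
Lemma cost_subgradient_bounded (c : T -> 'rV[R]_n1) :
  (forall t x, Xbar x -> - lval (xs t) (z t) + dot (c t) (x - z t) <= - lval (xs t) x) ->
  exists K, \forall t \near F, forall i, `|c t 0 i| <= K.
Proof.
move=> hc; apply: (coord_bounded_of_dot aXbar za) => x Xx.
exists (lval a a - lval a x + 1).
have D : lval (xs t) (z t) - lval (xs t) x @[t --> F] --> lval a a - lval a x.
  exact: (cvgB lval_cvg (lval_cvg1 Xx)).
apply: filterS ((cvgrPdist_le _ _).1 D 1 ltr01) => t.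
by rewrite ler_norml => /andP[]; have := hc t x Xx; lra.
Qed.

End Limit.

End LiftedRecourse.

(** * Optimality conditions and assembly of the limit *)

(** The sandwich is applied to the increment of phi - g at a, nonnegative on X - a. Its linear
    minorant L splits g into the subgradient L + g and the normal -L. *)
Lemma subdifferential_constrained (R : realType) (n : nat)
    (phi : 'rV[R]_n -> R) (X : set 'rV[R]_n) (a g : 'rV[R]_n) :
  convex_on setT phi -> convex_stable X -> X a ->
  (forall x, X x -> phi a + dot g (x - a) <= phi x) ->
  exists u v, [/\ subdifferential (EFin \o phi) a u, normal_cone X a v & u + v = g].
Proof.
move=> phic Xc Xa hg.
pose h d := phi (a + d) - phi a - dot g d.
pose C := [set d | X (a + d)].
have combE (d e : 'rV[R]_n) (t : R) :
    a + (t *: d + (1 - t) *: e) = t *: (a + d) + (1 - t) *: (a + e).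
  by apply/rowP => i; rewrite !mxE; ring.
have [|||||L [Lh LC]] := @convex_sandwich R n h C.
- move=> d e t _ _ t01; rewrite /h combE !dot_lin.
  by have := phic (a + d) (a + e) t I I t01; lra.
- by move=> d e t Cd Ce t01; rewrite /C /= combE; exact: Xc.
- by rewrite /C /= addr0.
- by rewrite /h addr0 subrr /dot trmx0 mulmx0 mxE subrr.
- by move=> c Cc; have := hg _ Cc; rewrite [a + c - a]addrAC subrr add0r /h; lra.
exists (L + g), (- L); split; last by rewrite addrC addKr.
- split=> // x; rewrite /= -EFinD lee_fin dotDl.
  by have := Lh (x - a); rewrite /h subrKC; lra.
- by split=> // x Xx; rewrite dotNl oppr_le0; apply: LC; rewrite /C /= subrKC.
Qed.

(** The averaged surrogate is a quadratic minus a linear form p plus a constant containing the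
    envelope values. The slope p - w/gamma is then regrouped around z, so that its last term is
    controlled by the stopping test. *)
Lemma surrogate_minimizer_variational (R : realType) (n1 n2 l S : nat)
    (X Xbar : set 'rV[R]_n1) (phi : 'rV[R]_n1 -> R)
    (f : 'I_S -> 'rV[R]_n1 -> 'rV[R]_n2 -> R)
    (G : 'I_S -> 'rV[R]_n1 -> 'rV[R]_n2 -> 'rV[R]_l)
    (gamma : R) (z w : 'rV[R]_n1) (xs cs : 'I_S -> 'rV[R]_n1) :
  (0 < S)%N -> 0 < gamma -> convex_stable X -> convex_on setT phi ->
  minimizer X (fun x => phi x + S%:R^-1 *
    \sum_s moreau_surrogate Xbar (f s) (G s) gamma z (xs s) (cs s) x) w ->
  forall x, X x ->
    phi w + dot (S%:R^-1 *: (\sum_s (cs s - gamma^-1 *: (z - xs s)))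
                 + gamma^-1 *: (z - w)) (x - w) <= phi x.
Proof.
move=> S0 g0 Xc phic [Xw wmin].
have SN0 : S%:R != 0 :> R by rewrite pnatr_eq0 -lt0n.
pose p := S%:R^-1 *: \sum_s (gamma^-1 *: xs s + cs s).
pose K := S%:R^-1 * \sum_s (dot (gamma^-1 *: xs s + cs s) z
  - ((2 * gamma)^-1 * enorm z ^+ 2 - moreau_envelope Xbar (f s) (G s) gamma z)).
have modelE x : S%:R^-1 *
    \sum_s moreau_surrogate Xbar (f s) (G s) gamma z (xs s) (cs s) x
    = (2 * gamma)^-1 * dot x x - dot p x + K.
  rewrite /K /p dotZl dot_suml.
  have -> : (2 * gamma)^-1 * dot x x = S%:R^-1 * \sum_(s < S) (2 * gamma)^-1 * dot x x.
    by rewrite sumr_const card_ord -(mulr_natl ((2 * gamma)^-1 * dot x x)) mulrA mulVf// mul1r.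
  rewrite -mulrBr -mulrDr -sumrB -big_split /=; congr (_ * _).
  apply: eq_bigr => s _; rewrite /moreau_surrogate sqr_enorm dotDr dotNr; ring.
have g2 : 2 * (2 * gamma)^-1 = gamma^-1 by field; rewrite gt_eqF.
have g20 : 0 <= (2 * gamma)^-1 by rewrite invr_ge0 mulr_ge0// ltW.
have wmin' x : X x -> phi w + (2 * gamma)^-1 * dot w w - dot p w
    <= phi x + (2 * gamma)^-1 * dot x x - dot p x.
  by move=> Xx; have := wmin x Xx; rewrite !modelE; lra.
have phiX : convex_on X phi by move=> x y t _ _; exact: phic.
move=> x Xx; have := prox_variational Xc phiX Xw g20 wmin' Xx.
rewrite g2.
suff -> : p - gamma^-1 *: w = S%:R^-1 *: (\sum_s (cs s - gamma^-1 *: (z - xs s)))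
                 + gamma^-1 *: (z - w) by [].
have -> : \sum_s (cs s - gamma^-1 *: (z - xs s)) =
    \sum_s (gamma^-1 *: xs s + cs s) - \sum_(s < S) gamma^-1 *: z.
  by rewrite -sumrB; apply: eq_bigr => s _; apply/rowP => i; rewrite !mxE; ring.
rewrite sumr_const card_ord scalerBr -/p -[_ *: z *+ S]scaler_nat.
rewrite [S%:R^-1 *: (_ *: _)]scalerA mulVf// scale1r scalerBr.
by rewrite addrA subrK.
Qed.

Lemma inner_loop_last_step (R : realType) (n1 n2 l S : nat)
    (X Xbar : set 'rV[R]_n1) (phi : 'rV[R]_n1 -> R)
    (f : 'I_S -> 'rV[R]_n1 -> 'rV[R]_n2 -> R)
    (G : 'I_S -> 'rV[R]_n1 -> 'rV[R]_n2 -> 'rV[R]_l)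
    (gamma eps : R) (z w : 'rV[R]_n1) :
  X z -> inner_loop X Xbar phi f G gamma eps z w ->
  exists z', [/\ X z', enorm (z' - w) <= eps * gamma &
    inner_step X Xbar phi f G gamma z' w].
Proof.
move=> Xz [u [N [u0 ustep _ uN ->]]]; exists (u N); split; last exact: ustep.
  (* If N = 0 the iterate is the starting point; otherwise it is a minimizer over X from the
     preceding pass. *)
  case: N ustep {uN} => [|N] ustep; first by rewrite u0.
  by have [? [? [? [_ _ []]]]] := ustep N (leqnSn N).
by rewrite -enormN opprB.
Qed.

(** Outer loop nu is studied through its output x_{nu+1}, so the accumulation point is moved to the
    shifted sequence. *)
Lemma cluster_shift (V : topologicalType) (x : nat -> V) (a : V) :
  cluster (x nu @[nu --> \oo]) a -> cluster (x nu.+1 @[nu --> \oo]) a.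
Proof.
move=> xa A B [N _ NA] aB; apply: xa aB; exists N.+1 => // -[//|nu] /= Nnu.
exact: NA.
Qed.

Theorem theorem1 (R : realType) (n1 n2 m l S : nat) (hS : (0 < S)%N)
  (X Xbar : set 'rV[R]_n1)
  (X_nonempty : X !=set0) (Xbar_nonempty : Xbar !=set0)
  (X_convex : convex_set X) (Xbar_convex : convex_set Xbar)
  (X_compact : compact X) (Xbar_compact : compact Xbar)
  (X_int : X `<=` interior Xbar)
  (phi : 'rV[R]_n1 -> R) (phi_convex : convex_function setT phi)
  (Xi : set 'rV[R]_m) (Xi_closed : closed Xi)
  (xi : 'I_S -> 'rV[R]_m) (xi_in : forall s, Xi (xi s))
  (f : 'rV[R]_m -> 'rV[R]_n1 -> 'rV[R]_n2 -> R)
  (G : 'rV[R]_m -> 'rV[R]_n1 -> 'rV[R]_n2 -> 'rV[R]_l)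
  (f_cont : forall w, Xi w ->
     continuous (fun p : 'rV[R]_n1 * 'rV[R]_n2 => f w p.1 p.2))
  (G_cont : forall w, Xi w ->
     continuous (fun p : 'rV[R]_n1 * 'rV[R]_n2 => G w p.1 p.2))
  (f_concave : forall w, Xi w -> forall y,
     convex_function setT (fun x => - f w x y))
  (f_convex : forall w, Xi w -> forall x, convex_function setT (f w x))
  (G_convex : forall w, Xi w -> forall i : 'I_l,
     convex_function setT
       (fun p : 'rV[R]_n1 * 'rV[R]_n2 => G w p.1 p.2 0 i))
  (assumptionA : forall s, lifted_solvable Xbar (f (xi s)) (G (xi s)))
  (assumptionB : forall s, lifted_lipschitz Xbar (f (xi s)) (G (xi s)) X)
  (gamma eps : nat -> R)
  (gamma_gt0 : forall nu, 0 < gamma nu) (eps_gt0 : forall nu, 0 < eps nu)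
  (gamma_decr : nonincreasing_seq gamma) (eps_decr : nonincreasing_seq eps)
  (gamma_cvg0 : gamma nu @[nu --> \oo] --> (0 : R))
  (eps_cvg0 : eps nu @[nu --> \oo] --> (0 : R))
  (x : nat -> 'rV[R]_n1)
  (x_generated : generated_by_decomposition X Xbar phi
     (fun s => f (xi s)) (fun s => G (xi s)) gamma eps x)
  (xbar : 'rV[R]_n1) (xbar_acc : cluster (x nu @[nu --> \oo]) xbar) :
  critical_point X Xbar phi (fun s => f (xi s)) (fun s => G (xi s)) xbar.
Proof.
have Xsub : X `<=` Xbar by move=> v /X_int /interior_subset.
have Xc := convex_set_stable X_convex; have Xbc := convex_set_stable Xbar_convex.
have phic := convex_function_on phi_convex.
have fconc s y := convex_function_on (f_concave _ (xi_in s) y).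
have fconv s v := convex_function_on (f_convex _ (xi_in s) v).
have Gconv s i := convex_function_on (G_convex _ (xi_in s) i).
have /choice[kappa kappaP] : forall s, exists k, 0 <= k /\
    forall x1 x2 z, Xbar x1 -> Xbar x2 -> X z ->
    `|lval Xbar (f (xi s)) (G (xi s)) x1 z - lval Xbar (f (xi s)) (G (xi s)) x2 z|
      <= k * enorm (x1 - x2).
  move=> s.
  by have [k] := lval_lipschitz (assumptionA s) Xsub (assumptionB s); exists k.
have [Xx0 xloop] := x_generated.
have Xx nu : X (x nu).
  elim: nu => // nu IH.
  by have [? [_ _ [? [? [? [_ _ []]]]]]] := inner_loop_last_step IH (xloop nu).
(* The data of each last pass are chosen at once: entering iterate, proximal points, second-stage
   solutions and cost subgradients. *)
have /choice[D DP] : forall nu, exists D : 'rV[R]_n1 * ('I_S -> 'rV[R]_n1) *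
    ('I_S -> 'rV[R]_n2) * ('I_S -> 'rV[R]_n1),
    [/\ X D.1.1.1, enorm (D.1.1.1 - x nu.+1) <= eps nu * gamma nu,
        forall s, minimizer (prox_feasible Xbar (G (xi s)))
          (prox_objective (f (xi s)) (gamma nu) D.1.1.1) (D.1.1.2 s, D.1.2 s),
        forall s, subdiff1_opp_cost (f (xi s)) D.1.1.1 (D.1.2 s) (D.2 s) &
        forall x', X x' -> phi (x nu.+1) +
          dot (S%:R^-1 *: (\sum_s (D.2 s - (gamma nu)^-1 *: (D.1.1.1 - D.1.1.2 s)))
                 + (gamma nu)^-1 *: (D.1.1.1 - x nu.+1)) (x' - x nu.+1) <= phi x'].
  move=> nu.
  have [z [Xz zw [xs [ys [cs [pmin csub wmin]]]]]] :=
    inner_loop_last_step (Xx nu) (xloop nu).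
  exists (z, xs, ys, cs); split=> //=.
  exact: surrogate_minimizer_variational hS (gamma_gt0 nu) Xc phic wmin.
pose z nu := (D nu).1.1.1; pose xs s nu := (D nu).1.1.2 s.
pose ys s nu := (D nu).1.2 s; pose c s nu := (D nu).2 s.
pose b s nu := (gamma nu)^-1 *: (z nu - xs s nu).
pose r nu := (gamma nu)^-1 *: (z nu - x nu.+1).
have [U [UU Uoo Ux]] := cluster_ultra _ (cluster_shift xbar_acc).
have gU : gamma @ U --> 0 by apply: cvg_trans gamma_cvg0; exact: cvg_app.
have eU : eps @ U --> 0 by apply: cvg_trans eps_cvg0; exact: cvg_app.
have Xz nu : X (z nu) by case: (DP nu).
have pmin s nu : minimizer (prox_feasible Xbar (G (xi s)))
    (prox_objective (f (xi s)) (gamma nu) (z nu)) (xs s nu, ys s nu).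
  by case: (DP nu).
have csub s nu : subdiff1_opp_cost (f (xi s)) (z nu) (ys s nu) (c s nu).
  by case: (DP nu).
have Xxs s nu : Xbar (xs s nu) by case: (pmin s nu) => -[].
(* The stopping bound eps gamma divided by gamma leaves eps. *)
have rU : r @ U --> (0 : 'rV[R]_n1).
  apply: enorm_squeeze eU => nu; have [_ + _ _ _] := DP nu.
  by rewrite enormZ ?invr_ge0 ?(ltW (gamma_gt0 nu))// ler_pdivrMl// mulrC.
have zU : z @ U --> xbar.
  rewrite -[xbar]addr0 -[X in _ + X](scaler0 _ 0).
  rewrite (_ : z = fun nu => x nu.+1 + gamma nu *: r nu).
    exact: (cvgD Ux (cvgZ gU rU)).
  by apply/funext => nu; rewrite /r scalerA divff ?gt_eqF// scale1r subrKC.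
have Xa : X xbar.
  apply: (closed_cvg X _ _ _ Ux); last by apply: nearW => nu.
  by apply: compact_closed X_compact; exact: norm_hausdorff.
(* Interiority gives continuity of the lifted function in each argument at [xbar] and the test
   points that bound the [c s]. *)
have Xba : nbhs xbar Xbar := X_int _ Xa.
have /choice[b0 b0P] : forall s, exists b0 : 'rV[R]_n1, b s @ U --> b0.
  move=> s; apply: (ultra_bounded_cvg (K := kappa s)); apply: nearW => nu i.
  apply: le_trans (coord_le_enorm _ _) _; have [k0 kP] := kappaP s.
  exact: (prox_displacement Xbc (fconv s) (Gconv s) (assumptionA s) (gamma_gt0 nu)
    (Xsub _ (Xz nu)) (pmin s nu) k0 (Xz nu) kP).
have xsU s : xs s @ U --> xbar.
  rewrite -[xbar]subr0 -[X in _ - X](scale0r (b0 s)).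
  rewrite (_ : xs s = fun nu => z nu - gamma nu *: b s nu).
    exact: (cvgB zU (cvgZ gU (b0P s))).
  apply/funext => nu; rewrite /b scalerA divff ?gt_eqF// scale1r.
  by rewrite opprB subrKC.
have hb s nu v : Xbar v ->
    lval Xbar (f (xi s)) (G (xi s)) (xs s nu) (z nu) + dot (b s nu) (v - xs s nu)
      <= lval Xbar (f (xi s)) (G (xi s)) v (z nu).
  exact: (prox_subgradient Xbc (fconv s) (Gconv s) (assumptionA s) (gamma_gt0 nu)
    (Xsub _ (Xz nu)) (pmin s nu)).
have hc s nu v : Xbar v ->
    - lval Xbar (f (xi s)) (G (xi s)) (xs s nu) (z nu) + dot (c s nu) (v - z nu)
      <= - lval Xbar (f (xi s)) (G (xi s)) (xs s nu) v.
  exact: (cost_subgradient (assumptionA s) (Xsub _ (Xz nu)) (pmin s nu) (csub s nu)).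
have /choice[c0 c0P] : forall s, exists c0 : 'rV[R]_n1, c s @ U --> c0.
  move=> s; have [K cK] := cost_subgradient_bounded Xbc (fconc s) (fconv s) (Gconv s)
    (assumptionA s) Xba (kappaP s).2 Xz (Xxs s) zU (xsU s) (hc s).
  exact: ultra_bounded_cvg cK.
(* The limit of the slopes in the variational inequalities, the term [r] having vanished. *)
pose g := S%:R^-1 *: \sum_s (c0 s - b0 s).
have VI v : X v -> phi xbar + dot g (v - xbar) <= phi v.
  move=> Xv; apply: (cvg_le (F := U) (v := fun=> phi v)); last first.
  - by move=> nu; have [_ _ _ _] := DP nu; apply.
  - exact: cvg_cst.
  apply: cvgD.
    exact: (cvg_comp _ phi Ux (convex_continuous_at phic filterT)).
  apply: dot_cvg; last exact: (cvgB (cvg_cst v) Ux).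
  rewrite -[g]addr0; apply: cvgD rU.
  apply: cvgZr; apply: cvg_big => [|s _]; first exact: add_continuous.
  exact: (cvgB (c0P s) (b0P s)).
have [u [v [uS vN uv]]] := subdifferential_constrained phic Xc Xa VI.
(* The scenario part of the sum is -g, which cancels u + v = g. *)
exists (u + S%:R^-1 *: \sum_s (b0 s - c0 s)).
  exists u => //; exists (S%:R^-1 *: \sum_s (b0 s - c0 s)) => //.
  exists (\sum_s (b0 s - c0 s)) => //; exists (fun s => b0 s - c0 s) => // s.
  exists (b0 s).
    exact: (subdiff1_limit Xbc (fconc s)
      (assumptionA s) Xba (kappaP s).2 Xz (Xxs s) zU (xsU s) (b0P s) (hb s)).
  exists (c0 s) => //.
  exact: (subdiff2_limit Xbc (fconc s) (fconv s) (Gconv s)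
    (assumptionA s) Xba (kappaP s).2 Xz (Xxs s) zU (xsU s) (c0P s) (hc s)).
exists v => //; rewrite addrAC uv /g -scalerDr -big_split /=.
by rewrite big1 ?scaler0// => s _; rewrite addrC subrKA subrr.
Qed.
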